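(* Let $f=2$ and $d=1$. For each $t\in\{3,5,7\}$ there is no discreet strategy for the parameters $(t,2,1)$.
   Context: There are $t$ distinguishable coins, identified with a set $T$ with $|T|=t$. All real coins weigh the same, all fake coins weigh the same, and a fake coin is lighter than a real one. Exactly $f$ coins are fake; the lawyer knows the true set $F\subset T$ of fake coins, $|F|=f$. The judge only knows in advance that the number of fake coins is either $f$ or $d$. A weighing places $n\ge 1$ coins on the left pan and $n$ other coins on the right pan of a balance scale; its outcome is one of ''balanced'', ''left pan lighter'', ''right pan lighter'' (the pan with more fake coins is lighter; the pans balance if they contain equally many fake coins). For a finite sequence of weighings performed with true fake set $F$, a set $S\subseteq T$ is consistent if, were $S$ the set of fake coins, every weighing would have the same outcome as it has for $F$. A strategy for $(t,f,d)$ is a choice of $F$ with $|F|=f$ and a finite sequence of weighings that proves to the judge that there are exactly $f$ fake coins, i.e. no set $S$ with $|S|=d$ is consistent. It is discreet if no information about any particular coin is revealed: for every coin $c\in T$ there is a consistent set $S$ with $|S|=f$ and $c\in S$, and also a consistent set $S'$ with $|S'|=f$ and $c\notin S'$. *)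

(* Defs.v *)
From mathcomp Require Import all_boot.

Set Implicit Arguments.
Unset Strict Implicit.
Unset Printing Implicit Defensive.

Record weighing (T : finType) := Weighing {
  left_pan : {set T};
  right_pan : {set T};
  pans_disjoint : [disjoint left_pan & right_pan];
  pans_same_size : #|left_pan| = #|right_pan|;
  pans_nonempty : 0 < #|left_pan|
}.

Inductive outcome := Balanced | LeftLighter | RightLighter.

(* Fake coins are lighter than real ones and the pans hold equally many coins,
   so the pan with more fake coins is the lighter one. *)
Definition weigh (T : finType) (S : {set T}) (w : weighing T) : outcome :=
  let l := #|left_pan w :&: S| in
  let r := #|right_pan w :&: S| in
  if l == r then Balanced else if r < l then LeftLighter else RightLighter.

Definition consistent (T : finType) (F : {set T}) (ws : seq (weighing T))
    (S : {set T}) : Prop :=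
  [seq weigh S w | w <- ws] = [seq weigh F w | w <- ws].

(* The number t of coins is #|T|. The weighings form a plain sequence: the
   lawyer knows the fake set, so adaptivity plays no role. *)
Record strategy (T : finType) (f d : nat) := Strategy {
  fake : {set T};
  weighings : seq (weighing T);
  card_fake : #|fake| = f;
  excludes_d : forall S : {set T}, #|S| = d -> ~ consistent fake weighings S
}.

Definition discreet (T : finType) (f d : nat) (s : strategy T f d) : Prop :=
  forall c : T,
    (exists S : {set T},
       [/\ #|S| = f, consistent (fake s) (weighings s) S & c \in S]) /\
    (exists S' : {set T},
       [/\ #|S'| = f, consistent (fake s) (weighings s) S' & c \notin S']).

(* Main.v *)
Require Import Defs.
From mathcomp Require Import all_boot.
From mathcomp Require Import all_order all_algebra.
From mathcomp Require Import zify.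

(** A discreet strategy for two fake coins against one can only use balanced
    weighings: if the left pan were lighter, no coin of the right pan could
    belong to a consistent pair, although discreetness puts every coin in one
    (lemma [discreet_balanced]).

    Attach to each coin its signature, the vector over all weighings with
    entry 1, -1 or 0 when the coin lies on the left, on the right or aside.  As
    all weighings balance, a set is consistent exactly when its signatures add
    up to zero (lemma [consistentP]).  Three facts follow.  No signature is
    zero, since no single coin is consistent.  Every signature has its opposite
    among the other signatures, since every coin lies in a consistent pair.
    All the signatures add up to zero, since the pans of a weighing hold
    equally many coins.

    Group the coins into blocks, one for each signature up to sign.  Say that a
    block is unbalanced when its two signs occur unequally often; as both signs
    occur, it then has at least three coins.  A balanced block has even size
    and signature sum zero.  If the number of coins is odd, some block is
    unbalanced, and the sums over the unbalanced blocks, which are nonzero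
    multiples of their signatures, add up to zero.  One such block is not
    enough as its signature is nonzero, and two are not enough as two
    proportional nonzero vectors with entries in -1, 0, 1 agree up to sign
    (lemma [sign_vectors_proportional]).  So there are three unbalanced blocks,
    hence at least nine coins (lemma [odd_signatures_ge9]). *)

Set Implicit Arguments.
Unset Strict Implicit.
Unset Printing Implicit Defensive.

Import Order.TTheory GRing.Theory Num.Theory.
Local Open Scope ring_scope.

(** Nonzero vectors with entries in -1, 0, 1 all have supremum norm 1, so the
    two coefficients of a dependency have the same absolute value. *)
Lemma sign_vectors_proportional m (u v : 'rV[int]_m) (a b : int) :
    (forall i, `|u 0 i| <= 1) -> (forall i, `|v 0 i| <= 1) ->
    u != 0 -> v != 0 -> a != 0 -> a *: u + b *: v = 0 ->
  u = v \/ u = - v.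
Proof.
move=> u1 v1 u0 v0 a0 /rowP uv.
have uvE i : a * u 0 i + b * v 0 i = 0 by have := uv i; rewrite !mxE.
have normE i : `|a| * `|u 0 i| = `|b| * `|v 0 i|.
  by rewrite -!normrM; have := uvE i; lia.
have /rV0Pn[i ui0] := u0; have /rV0Pn[j vj0] := v0.
have ui1 : `|u 0 i| = 1 by apply/eqP; rewrite eq_le u1 -gtz0_ge1 normr_gt0.
have vj1 : `|v 0 j| = 1 by apply/eqP; rewrite eq_le v1 -gtz0_ge1 normr_gt0.
(* Where one of the vectors has an entry of norm 1, the relation bounds the
   coefficient of that vector by the other coefficient. *)
have ab1 : `|a| <= `|b|.
  by have := normE i; rewrite ui1 mulr1 => ->; apply: ler_piMr.
have ba1 : `|b| <= `|a|.
  by have := normE j; rewrite vj1 mulr1 => <-; apply: ler_piMr.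
have [ab | ab] : a = b \/ a = - b by lia.
- right; apply/rowP => k; rewrite !mxE; apply: (mulfI a0).
  by have := uvE k; rewrite -ab mulrN => /eqP; rewrite addr_eq0 => /eqP.
- left; apply/rowP => k; apply: (mulfI a0).
  by have := uvE k; rewrite ab !mulNr => /eqP; rewrite addrC subr_eq0 => /eqP ->.
Qed.

Section Signatures.

Variables (T : finType) (m : nat) (v : T -> 'rV[int]_m).
Hypothesis v_le1 : forall c i, `|v c 0 i| <= 1.
Hypothesis v_neq0 : forall c, v c != 0.
Hypothesis v_opp : forall c, exists c', v c' = - v c.
Hypothesis v_sum : \sum_c v c = 0.

Definition same_up_to_sign c c' := (v c' == v c) || (v c' == - v c).

Lemma same_up_to_sign_equiv :
  {in [set: T] & &, equivalence_rel same_up_to_sign}.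
Proof.
rewrite /same_up_to_sign => x y z _ _ _; split; first by rewrite eqxx.
by move=> /orP[] /eqP ->; rewrite // opprK orbC.
Qed.

Definition blocks := equivalence_partition same_up_to_sign [set: T].

Lemma partition_blocks : partition blocks [set: T].
Proof. exact/equivalence_partitionP/same_up_to_sign_equiv. Qed.

Lemma blocksP (B : {set T}) :
  B \in blocks -> exists c, B = [set c' | same_up_to_sign c c'].
Proof.
move=> /imsetP[c _ ->]; exists c; apply/setP => c'.
by rewrite !inE.
Qed.

(** The coefficient of [v c] in the sum over the block of [c]; the block is
    balanced when it vanishes. *)
Definition excess c : int :=
  #|[set c' | v c' == v c]|%:Z - #|[set c' | v c' == - v c]|%:Z.

Lemma block_split c :
  [set c' | same_up_to_sign c c'] =
    [set c' | v c' == v c] :|: [set c' | v c' == - v c].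
Proof. by apply/setP => c'; rewrite !inE. Qed.

Lemma block_disjoint c :
  [disjoint [set c' | v c' == v c] & [set c' | v c' == - v c]].
Proof.
rewrite disjoints_subset; apply/subsetP => x; rewrite !inE => /eqP ->.
have /rV0Pn[i vi] := v_neq0 c.
by apply/eqP => /rowP/(_ i); rewrite mxE; move: (v c 0 i) vi => z; lia.
Qed.

Lemma card_block c :
  #|[set c' | same_up_to_sign c c']| =
    (#|[set c' | v c' == v c]| + #|[set c' | v c' == - v c]|)%N.
Proof.
by apply/eqP; rewrite block_split leq_card_setU block_disjoint.
Qed.

Lemma sum_block c :
  \sum_(c' in [set c' | same_up_to_sign c c']) v c' = excess c *: v c.
Proof.
rewrite block_split (eq_bigl _ _ (fun c' => in_setU c' _ _)) bigU ?block_disjoint //=.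
rewrite (eq_bigr (fun=> v c)); last by move=> x; rewrite inE => /eqP.
rewrite [X in _ + X](eq_bigr (fun=> - v c)); last by move=> x; rewrite inE => /eqP.
rewrite !sumr_const /excess scalerBl mulNrn.
by rewrite -!scaler_nat !natz.
Qed.

(** Both signs occur in the block, and unequally often. *)
Lemma card_block_ge3 c :
  excess c != 0 -> (3 <= #|[set c' | same_up_to_sign c c']|)%N.
Proof.
rewrite /excess card_block => /eqP.
have : (0 < #|[set c' | v c' == v c]|)%N by apply/card_gt0P; exists c; rewrite inE.
have : (0 < #|[set c' | v c' == - v c]|)%N.
  by have [c' vc'] := v_opp c; apply/card_gt0P; exists c'; rewrite inE vc'.
by lia.
Qed.

(** Nine is attained: take three vectors of sum zero, such as (1, -1, 0),
    (0, 1, -1) and (-1, 0, 1), each occurring twice and its opposite once. *)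
Lemma odd_signatures_ge9 : odd #|T| -> (9 <= #|T|)%N.
Proof.
move=> oddT.
have := partition_blocks; set P := blocks => partP.
have sumP : \sum_(B in P) \sum_(c in B) v c = 0.
  by rewrite -(set_partition_big _ partP) -[RHS]v_sum; apply: eq_bigl => c; rewrite inE.
have cardP : #|T| = (\sum_(B in P) #|B|)%N by rewrite -cardsT (card_partition partP).
(* A block is unbalanced exactly when its signatures do not add up to zero. *)
set U := [set B in P | \sum_(c in B) v c != 0].
have sumU : \sum_(B in U) \sum_(c in B) v c = 0.
  rewrite -[RHS]sumP [RHS](bigID (fun B : {set T} => \sum_(c in B) v c != 0)) /=.
  rewrite [X in _ = _ + X]big1 ?addr0; last by move=> B /andP[_ /negPn/eqP].
  by apply: eq_bigl => B; rewrite !inE.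
have U3 B : B \in U -> (3 <= #|B|)%N.
  rewrite inE => /andP[/blocksP[c ->]]; rewrite sum_block scalemx_eq0 negb_or.
  by move=> /andP[/card_block_ge3].
have cardU : (3 * #|U| <= #|T|)%N.
  rewrite cardP mulnC -sum_nat_const.
  rewrite [leqRHS](bigID (mem U)) /=; apply: leq_trans (leq_addr _ _).
  rewrite [leqRHS](eq_bigl (mem U)); first exact: leq_sum.
  by move=> B; rewrite /= !inE andbA andbb.
suff : (3 <= #|U|)%N by lia.
rewrite ltnNge; apply/negP => U2.
(* Exclude zero, one and two unbalanced blocks. *)
have [U0|[B /[dup] BU /[!inE] /andP[BP B0]]] := set_0Vmem U.
  suff : ~~ odd #|T| by rewrite oddT.
  rewrite cardP; elim/big_ind: _ => // [x y|B BP]; first by rewrite oddD => /negPf-> /negPf->.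
  have /[!inE]: B \notin U by rewrite U0 inE.
  rewrite BP /= negbK; have [c ->] := blocksP BP.
  rewrite sum_block scalemx_eq0 (negPf (v_neq0 c)) orbF /excess card_block.
  by lia.
have [B'0|[B' /[dup] B'U]] := set_0Vmem (U :\ B).
  move: sumU; rewrite (big_setD1 B) //= B'0 big_set0 addr0 => /eqP.
  by rewrite (negPf B0).
rewrite !inE => /and3P[BB' B'P B'0].
have U1 : #|U :\ B :\ B'| = 0%N.
  by have := cardsD1 B U; have := cardsD1 B' (U :\ B); rewrite BU B'U; lia.
move: sumU; rewrite (big_setD1 B) //= (big_setD1 B') //=.
rewrite (cards0_eq U1) big_set0 addr0.
have [c Bc] := blocksP BP; have [c' B'c] := blocksP B'P.
move: B0; rewrite Bc B'c !sum_block scalemx_eq0 negb_or => /andP[d0 _] rel.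
(* Two proportional signatures share a block, but B and B' are distinct. *)
have cc' : same_up_to_sign c' c.
  rewrite /same_up_to_sign.
  by have [->|->] := sign_vectors_proportional (v_le1 c) (v_le1 c') (v_neq0 c)
    (v_neq0 c') d0 rel; rewrite eqxx ?orbT.
case/eqP: BB'; rewrite Bc B'c; apply/setP => x; rewrite !inE.
by have [_ /(_ cc')] := same_up_to_sign_equiv (in_setT c') (in_setT c) (in_setT x).
Qed.

End Signatures.

Definition side (T : finType) (w : weighing T) (c : T) : int :=
  (c \in left_pan w)%:R - (c \in right_pan w)%:R.

Lemma side_le1 (T : finType) (w : weighing T) c : `|side w c| <= 1.
Proof. by rewrite /side; case: (_ \in _); case: (_ \in _). Qed.

Lemma sum_side (T : finType) (S : {set T}) (w : weighing T) :
  \sum_(c in S) side w c =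
    #|left_pan w :&: S|%:Z - #|right_pan w :&: S|%:Z.
Proof.
have card_sum (A : {set T}) : \sum_(c in S) (c \in A)%:R = #|A :&: S|%:Z.
  rewrite -[RHS]natz -sum1_card natr_sum [LHS](bigID (mem A)) /=.
  rewrite [X in _ + X]big1 ?addr0; last by move=> c /andP[_ /negPf->].
  by apply: eq_big => [c|c /andP[_ ->]] //; rewrite inE andbC.
by rewrite big_split /= sumrN !card_sum.
Qed.

Lemma weigh_balanced (T : finType) (S : {set T}) (w : weighing T) :
  weigh S w = Balanced <-> \sum_(c in S) side w c = 0.
Proof. by rewrite sum_side /weigh; case: eqP; [|case: ltnP]; split => //; lia. Qed.

Lemma consistent_tnth (T : finType) (F S : {set T}) (ws : seq (weighing T)) :
  consistent F ws S <->
    forall i, weigh S (tnth (in_tuple ws) i) = weigh F (tnth (in_tuple ws) i).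
Proof.
rewrite /consistent; split => [eqFS i | eqFS].
  set w := tnth _ i; have wE : nth w ws i = w by rewrite [RHS](tnth_nth w).
  have := congr1 (fun os => nth Balanced os i) eqFS.
  by rewrite /= !(nth_map w) // wE.
have /(congr1 val) // :
    map_tuple (weigh S) (in_tuple ws) = map_tuple (weigh F) (in_tuple ws).
by apply: eq_from_tnth => i; rewrite !tnth_map.
Qed.

(** The other pan can hold at most the second of the two coins. *)
Lemma pair_pan_le (T : finType) (A B S : {set T}) c :
  [disjoint A & B] -> #|S| = 2 -> c \in S -> c \in B ->
  (#|A :&: S| <= #|B :&: S|)%N.
Proof.
move=> AB S2 cS cB.
have : (0 < #|B :&: S|)%N by apply/card_gt0P; exists c; rewrite inE cB.
have : (#|A :&: S| + #|B :&: S| <= #|S|)%N.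
  rewrite -cardsUI -setIUl setIACA.
  move: AB; rewrite -setI_eq0 => /eqP ->.
  by rewrite set0I cards0 addn0 subset_leq_card // subsetIr.
lia.
Qed.

Section DiscreetStrategy.

Variables (T : finType) (s : strategy T 2 1).
Hypothesis s_discreet : discreet s.

Let F := fake s.
Let w i := tnth (in_tuple (weighings s)) i.

(** A coin of the heavier pan lies in no consistent pair: a pair containing it
    would have to tilt the scale the other way or not at all. *)
Lemma discreet_balanced i : weigh F (w i) = Balanced.
Proof.
have dis := pans_disjoint (w i).
case wF: (weigh F (w i)) => //.
- have /card_gt0P[c cR] : (0 < #|right_pan (w i)|)%N.
    by rewrite -pans_same_size pans_nonempty.
  have [[S [S2 /consistent_tnth/(_ i) + cS]] _] := s_discreet c.
  have := pair_pan_le dis S2 cS cR.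
  by rewrite -/(w i) wF /weigh; case: eqP => // _; rewrite leqNgt => /negPf->.
- have /card_gt0P[c cL] := pans_nonempty (w i).
  have [[S [S2 /consistent_tnth/(_ i) + cS]] _] := s_discreet c.
  rewrite disjoint_sym in dis; have := pair_pan_le dis S2 cS cL.
  by rewrite -/(w i) wF /weigh; case: eqP => // /eqP; case: ltngtP.
Qed.

Definition signature c : 'rV[int]_(size (weighings s)) :=
  \row_i side (w i) c.

Lemma consistentP (S : {set T}) :
  consistent F (weighings s) S <-> \sum_(c in S) signature c = 0.
Proof.
have sumE i : (\sum_(c in S) signature c) 0 i = \sum_(c in S) side (w i) c.
  by rewrite summxE; apply: eq_bigr => c _; rewrite mxE.
split=> [/consistent_tnth cS | sS].
  apply/rowP => i; rewrite sumE mxE; apply/weigh_balanced.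
  by rewrite cS discreet_balanced.
apply/consistent_tnth => i; rewrite discreet_balanced; apply/weigh_balanced.
by rewrite -sumE sS mxE.
Qed.

Lemma discreet_odd_ge9 : odd #|T| -> (9 <= #|T|)%N.
Proof.
apply: (@odd_signatures_ge9 _ _ signature).
- by move=> c i; rewrite mxE side_le1.
- move=> c; apply/eqP => c0; apply: (@excludes_d _ _ _ s [set c]); first by rewrite cards1.
  by apply/consistentP; rewrite big_set1.
- move=> c; have [[S [S2 /consistentP + cS]] _] := s_discreet c.
  have := cardsD1 c S; rewrite cS S2 => -[/esym/eqP/cards1P[c' Sc']].
  rewrite (big_setD1 c) //= Sc' big_set1 => /eqP.
  by rewrite addrC addr_eq0 => /eqP; exists c'.
- apply/rowP => i; rewrite summxE mxE.
  transitivity (\sum_(c in [set: T]) side (w i) c).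
    by apply: eq_big => [c|c _]; rewrite ?inE ?mxE.
  by rewrite sum_side !setIT pans_same_size subrr.
Qed.

End DiscreetStrategy.

Local Close Scope ring_scope.

Theorem corollary8 (T : finType) (t : nat) (ht : t \in [:: 3; 5; 7])
    (hT : #|T| = t) :
  ~ exists s : strategy T 2 1, discreet s.
Proof.
case=> s /discreet_odd_ge9; rewrite hT.
by move: ht; rewrite !inE => /or3P[] /eqP-> /(_ isT).
Qed.
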